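(* There exists an algorithm which, given a finite argumentation framework $F=\langle\mathcal{A},\mathcal{R}\rangle$ together with the family $\mathrm{IRR}(F)$ of its irreducible self-defending sets, enumerates $\mathrm{PREF}(F)$ with polynomial delay and polynomial space in the size of $\mathrm{IRR}(F)$ and $F$.
   Context: All objects are finite. An argumentation framework is a pair $F=\langle \mathcal{A},\mathcal{R}\rangle$ where $\mathcal{A}$ is a finite set (of arguments) and $\mathcal{R}\subseteq\mathcal{A}\times\mathcal{A}$ (attacks; self-attacks are allowed). For $S\subseteq\mathcal{A}$: $S^+=\{x\in\mathcal{A}\mid \exists y\in S,\ (y,x)\in\mathcal{R}\}$ and $S^-=\{x\in\mathcal{A}\mid \exists y\in S,\ (x,y)\in\mathcal{R}\}$. A set $S\subseteq\mathcal{A}$ is conflict-free if $S\cap S^+=\emptyset$, self-defending if $S^-\subseteq S^+$, and admissible if it is both; $\mathrm{SD}(F)$ is the family of self-defending sets. Preferred extensions are the inclusion-wise maximal admissible sets, forming the family $\mathrm{PREF}(F)$. A self-defending set $S\in\mathrm{SD}(F)$ with $S\neq\emptyset$ is irreducible if for all $S_1,S_2\in\mathrm{SD}(F)$, $S=S_1\cup S_2$ implies $S=S_1$ or $S=S_2$; $\mathrm{IRR}(F)$ is the family of irreducible self-defending sets. An enumeration algorithm with input $x$ outputs all the elements of a solution set $R(x)$, each exactly once. It has polynomial delay if the time between two consecutive outputs, and the time after the last output, is bounded by a polynomial in the size of $x$; it uses polynomial space if the space used is bounded by a polynomial in the size of $x$. Here the input $x$ consists of $F$ and $\mathrm{IRR}(F)$.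 *)

(* Defs.v *)
From mathcomp Require Import all_boot ssralg poly.

Set Implicit Arguments.
Unset Strict Implicit.
Unset Printing Implicit Defensive.

Record framework := Framework {
  arg : finType;
  attacks : {set arg * arg} }.

Section Argumentation.
Variable F : framework.
Implicit Types S : {set arg F}.

(* S^+ and S^- *)
Definition attacked_by S : {set arg F} :=
  [set x | [exists y in S, (y, x) \in attacks F]].
Definition attackers_of S : {set arg F} :=
  [set x | [exists y in S, (x, y) \in attacks F]].

Definition conflict_free S : bool := S :&: attacked_by S == set0.
Definition self_defending S : bool := attackers_of S \subset attacked_by S.
Definition admissible S : bool := conflict_free S && self_defending S.

Definition SD : {set {set arg F}} := [set S | self_defending S].

Definition PREF : {set {set arg F}} := [set S | maxset admissible S].

Definition irreducible S : bool :=
  [forall S1 in SD, forall S2 in SD,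
     (S == S1 :|: S2) ==> (S == S1) || (S == S2)].

Definition IRR : {set {set arg F}} :=
  [set S in SD | (S != set0) && irreducible S].

End Argumentation.

(* Model of computation: Jones's WHILE language over binary trees, with one
   operation per instruction, and with output. A register holds a tree, one
   executed instruction or test is one step, and space is the total number of
   tree nodes in the registers, with no credit for sharing (the control point
   takes space depending on the program only). When the space is polynomial,
   a Turing machine simulates each step in polynomial time. *)

Inductive tree := Leaf | Node of tree & tree.

Fixpoint tree_size (t : tree) : nat :=
  if t is Node l r then (tree_size l + tree_size r).+1 else 1.

Definition hd (t : tree) : tree := if t is Node l _ then l else Leaf.
Definition tl (t : tree) : tree := if t is Node _ r then r else Leaf.

Inductive program :=
| SetNil of nat
| Copy of nat & nat
| SetCons of nat & nat & nat
| SetHd of nat & nat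
| SetTl of nat & nat
| Output of nat
| Seq of program & program
| If of nat & program & program
| While of nat & program.

(* Register x of the store s is nth Leaf s x, and is Leaf when never written. *)
Definition store := seq tree.
Definition read (s : store) (x : nat) : tree := nth Leaf s x.
Definition write (s : store) (x : nat) (t : tree) : store := set_nth Leaf s x t.
Definition space (s : store) : nat := sumn (map tree_size s).

(* One entry per step: the space occupied after the step, and the tree
   emitted during the step, if any. *)
Definition trace := seq (nat * option tree).
Definition tick (s : store) : nat * option tree := (space s, None).
Definition emit (s : store) (t : tree) : nat * option tree := (space s, Some t).

(* exec c s tr s': started on s, the program c terminates in s' after exactly
   the steps tr. Leaf is false and every other tree is true. *)
Inductive exec : program -> store -> trace -> store -> Prop :=
| ExecNil s x (s' := write s x Leaf) :
    exec (SetNil x) s [:: tick s'] s'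
| ExecCopy s x y (s' := write s x (read s y)) :
    exec (Copy x y) s [:: tick s'] s'
| ExecCons s x y z (s' := write s x (Node (read s y) (read s z))) :
    exec (SetCons x y z) s [:: tick s'] s'
| ExecHd s x y (s' := write s x (hd (read s y))) :
    exec (SetHd x y) s [:: tick s'] s'
| ExecTl s x y (s' := write s x (tl (read s y))) :
    exec (SetTl x y) s [:: tick s'] s'
| ExecOutput s x :
    exec (Output x) s [:: emit s (read s x)] s
| ExecSeq c1 c2 s1 s2 s3 t1 t2 :
    exec c1 s1 t1 s2 -> exec c2 s2 t2 s3 ->
    exec (Seq c1 c2) s1 (t1 ++ t2) s3
| ExecIfTrue x c1 c2 s s' t :
    read s x <> Leaf -> exec c1 s t s' ->
    exec (If x c1 c2) s (tick s :: t) s'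
| ExecIfFalse x c1 c2 s s' t :
    read s x = Leaf -> exec c2 s t s' ->
    exec (If x c1 c2) s (tick s :: t) s'
| ExecWhileTrue x c s1 s2 s3 t1 t2 :
    read s1 x <> Leaf -> exec c s1 t1 s2 -> exec (While x c) s2 t2 s3 ->
    exec (While x c) s1 (tick s1 :: t1 ++ t2) s3
| ExecWhileFalse x c s :
    read s x = Leaf ->
    exec (While x c) s [:: tick s] s.

Definition outputs (tr : trace) : seq tree := pmap snd tr.

(* delays 0 tr lists the number of steps up to and including the first
   output, then between consecutive outputs, then after the last output. *)
Fixpoint delays (d : nat) (tr : trace) : seq nat :=
  match tr with
  | [::] => [:: d]
  | (_, None) :: tr' => delays d.+1 tr'
  | (_, Some _) :: tr' => d.+1 :: delays 0 tr'
  end.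

Definition delay_bounded (b : nat) (tr : trace) : bool :=
  all (fun d => d <= b) (delays 0 tr).
Definition space_bounded (b : nat) (tr : trace) : bool :=
  all (fun e => e.1 <= b) tr.

(* Sets of arguments are encoded by characteristic vectors and the attack
   relation by its adjacency matrix, both indexed by enum (arg F). *)
Definition enc_bool (b : bool) : tree := if b then Node Leaf Leaf else Leaf.
Definition enc_seq (T : Type) (enc : T -> tree) (l : seq T) : tree :=
  foldr (fun x t => Node (enc x) t) Leaf l.

Definition enc_set (A : finType) (S : {set A}) : tree :=
  enc_seq (fun x => enc_bool (x \in S)) (enum A).

Definition enc_framework (F : framework) : tree :=
  enc_seq (fun x => enc_seq (fun y => enc_bool ((x, y) \in attacks F))
                            (enum (arg F)))
          (enum (arg F)).

Definition enc_input (F : framework) (irr : seq {set arg F}) : tree :=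
  Node (enc_framework F) (enc_seq (@enc_set (arg F)) irr).

(* l is a listing of the family X, each member exactly once. *)
Definition lists (T : finType) (l : seq T) (X : {set T}) : Prop :=
  uniq l /\ l =i X.

Definition enumerates (A : finType) (tr : trace) (X : {set {set A}}) : Prop :=
  exists2 l : seq {set A}, lists l X & outputs tr = map (@enc_set A) l.

(* Main.v *)
Require Import Defs.
From mathcomp Require Import all_boot ssralg poly.
From mathcomp Require Import zify.

(* Every self-defending set is the union of the irreducible ones it contains,
   and conflict-freeness of a union is a condition on pairs, so the preferred
   extensions are the maximal conflict-free unions of members of IRR, i.e. the
   maximal independent sets of a graph on IRR. These are enumerated as by
   Tsukiyama et al.: level j of a search tree holds the maximal conflict-free
   unions S of the first j members of IRR. For the next member I, the only child
   of S is S u I if that is conflict-free. Otherwise S is a child, and the union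
   C of I with the earlier members inside S compatible with I is another one,
   provided that C is maximal and that S is its canonical parent, the greedy
   completion of the earlier members inside C. Thus every node at level j + 1
   has exactly one parent and every node at level j has a child: a depth-first
   search meets a leaf after at most |IRR| + 1 nodes, with a stack of at most
   that many entries.
   The step of the search is a tree function assembled from combinators that
   preserve computability by WHILE programs in polynomial time and space. *)

Set Implicit Arguments.
Unset Strict Implicit.
Unset Printing Implicit Defensive.

(** * Polynomial-time tree functions *)

(** Polynomials with natural coefficients, kept as functions so that bounds stay plain arithmetic.
    They are monotone and closed under composition, so a size bound can be plugged into a time
    bound. *)
Inductive polyf : (nat -> nat) -> Prop :=
| polyf_const c : polyf (fun=> c)
| polyf_id : polyf (fun n => n)
| polyf_add f g : polyf f -> polyf g -> polyf (fun n => f n + g n)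
| polyf_mul f g : polyf f -> polyf g -> polyf (fun n => f n * g n)
| polyf_comp f g : polyf f -> polyf g -> polyf (fun n => f (g n)).

Lemma polyf_horner f : polyf f -> exists p : {poly nat}, forall n, f n = (p.[n])%R.
Proof.
elim=> {f} [c||f g _ [p Ef] _ [q Eg]|f g _ [p Ef] _ [q Eg]|f g _ [p Ef] _ [q Eg]].
- by exists (c%:P)%R => n; rewrite hornerC.
- by exists 'X%R => n; rewrite hornerX.
- by exists (p + q)%R => n; rewrite hornerD Ef Eg.
- by exists (p * q)%R => n; rewrite hornerM Ef Eg.
- by exists (p \Po q)%R => n; rewrite horner_comp Ef Eg.
Qed.

Lemma polyf_mono f : polyf f -> {homo f : m n / m <= n}.
Proof.
elim=> {f} [c|//|f g _ mf _ mg|f g _ mf _ mg|f g _ mf _ mg] m n // le_mn.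
- by rewrite leq_add ?mf ?mg.
- by rewrite leq_mul ?mf ?mg.
- by rewrite mf ?mg.
Qed.

Ltac polyf :=
  match goal with
  | |- polyf (fun n => n) => exact: polyf_id
  | |- polyf (fun n => ?c) => exact: (polyf_const c)
  | |- polyf (fun n => @?f n + @?g n) => apply: (@polyf_add f g); polyf
  | |- polyf (fun n => (@?f n).+1) => apply: (@polyf_add (fun=> 1) f); polyf
  | |- polyf (fun n => @?f n * @?g n) => apply: (@polyf_mul f g); polyf
  | |- polyf (fun n => ?f (@?g n)) => apply: (@polyf_comp f g); [by [] | polyf]
  end.

(** * Space of stores, register offsets and silent runs *)

Lemma tree_size_gt0 t : 0 < tree_size t.
Proof. by case: t. Qed.

Lemma space_cat s1 s2 : space (s1 ++ s2) = space s1 + space s2.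
Proof. by rewrite /space map_cat sumn_cat. Qed.

Lemma space_cons t s : space (t :: s) = tree_size t + space s.
Proof. by []. Qed.

Lemma space_nseq m : space (nseq m Leaf) = m.
Proof. by rewrite /space map_nseq sumn_nseq mul1n. Qed.

Lemma space_rcons s t : space (rcons s t) = space s + tree_size t.
Proof. by rewrite -cats1 space_cat space_cons addn0. Qed.

Lemma space_nil : space [::] = 0.
Proof. by []. Qed.

Definition spaceE := (space_nil, space_rcons, space_cat, space_cons, space_nseq, size_rcons).

Lemma read_cat L s i : read (L ++ s) (size L + i) = read s i.
Proof. by rewrite /read nth_cat ltnNge leq_addr addKn. Qed.

Lemma write_cat L s i t : write (L ++ s) (size L + i) t = L ++ write s i t.
Proof. by rewrite /write; elim: L => //= a L ->. Qed.

(** Runs without output: they only lengthen the current delay. *)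
Definition runs (c : program) (s s' : store) (T B : nat) : Prop :=
  exists tr, [/\ exec c s tr s', size tr <= T &
                 all (fun e => (e.1 <= B) && ~~ isSome e.2) tr].

Lemma runs_le T B T' B' c s s' :
  T <= T' -> B <= B' -> runs c s s' T B -> runs c s s' T' B'.
Proof.
move=> leT leB [tr [ex sz Htr]]; exists tr; split=> //; first exact: leq_trans leT.
by apply: sub_all Htr => e /andP[h ->]; rewrite (leq_trans h).
Qed.

Lemma runs_seq T1 c1 c2 s1 s2 s3 T B :
  runs c1 s1 s2 T1 B -> T1 <= T -> runs c2 s2 s3 (T - T1) B ->
  runs (Seq c1 c2) s1 s3 T B.
Proof.
move=> [t1 [e1 z1 a1]] leT [t2 [e2 z2 a2]]; exists (t1 ++ t2); split.
- exact: ExecSeq e1 e2.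
- by rewrite size_cat -(subnKC leT) leq_add.
- by rewrite all_cat a1.
Qed.

(** Registers are addressed as [size L + i] behind an untouched prefix [L], so each rule carries its
    own frame. Programs write [k + 0] to match this shape. *)
Section Instructions.
Variables (L R s' : store) (T B : nat).
Hypotheses (HT : 0 < T) (HB : space s' <= B).

Lemma runs_nil i : L ++ write R i Leaf = s' ->
  runs (SetNil (size L + i)) (L ++ R) s' T B.
Proof.
move=> E; exists [:: tick s']; split=> //=; last by rewrite HB.
by rewrite -E -write_cat; apply: ExecNil.
Qed.

Lemma runs_copy i j : L ++ write R i (read R j) = s' ->
  runs (Copy (size L + i) (size L + j)) (L ++ R) s' T B.
Proof.
move=> E; exists [:: tick s']; split=> //=; last by rewrite HB.
by rewrite -E -write_cat -(read_cat L); apply: ExecCopy.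
Qed.

Lemma runs_cons i j k : L ++ write R i (Node (read R j) (read R k)) = s' ->
  runs (SetCons (size L + i) (size L + j) (size L + k)) (L ++ R) s' T B.
Proof.
move=> E; exists [:: tick s']; split=> //=; last by rewrite HB.
by rewrite -E -write_cat -(read_cat L R j) -(read_cat L R k); apply: ExecCons.
Qed.

Lemma runs_hd i j : L ++ write R i (hd (read R j)) = s' ->
  runs (SetHd (size L + i) (size L + j)) (L ++ R) s' T B.
Proof.
move=> E; exists [:: tick s']; split=> //=; last by rewrite HB.
by rewrite -E -write_cat -(read_cat L); apply: ExecHd.
Qed.

Lemma runs_tl i j : L ++ write R i (tl (read R j)) = s' ->
  runs (SetTl (size L + i) (size L + j)) (L ++ R) s' T B.
Proof.
move=> E; exists [:: tick s']; split=> //=; last by rewrite HB.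
by rewrite -E -write_cat -(read_cat L); apply: ExecTl.
Qed.

End Instructions.

(* [c k] touches only registers [k] and above: its argument and result are in [k], and
   the [m >= w] registers after [k] are [Leaf] before and after the run. *)
Definition computes (f : tree -> tree) (c : nat -> program) (w : nat) (p : nat -> nat) : Prop :=
  forall L v m, w <= m ->
    tree_size (f v) <= p (tree_size v) /\
    runs (c (size L)) (L ++ v :: nseq m Leaf) (L ++ f v :: nseq m Leaf)
      (p (tree_size v)) (space L + m + p (tree_size v)).

Definition polytime (f : tree -> tree) : Prop :=
  exists c w p, polyf p /\ computes f c w p.

(** [R] joins the untouched prefix, so a subroutine can run on the scratch registers of its
    caller. *)
Lemma computes_at f c w p L R v m T B : computes f c w p -> w <= m ->
  p (tree_size v) <= T -> space L + space R + m + p (tree_size v) <= B ->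
  runs (c (size L + size R)) (L ++ (R ++ v :: nseq m Leaf))
    (L ++ (R ++ f v :: nseq m Leaf)) T B.
Proof.
move=> Cf le_wm leT leB; have [_] := Cf (L ++ R) v m le_wm.
by rewrite size_cat -!catA space_cat; apply: runs_le.
Qed.

Lemma computes_size f c w p v : computes f c w p -> tree_size (f v) <= p (tree_size v).
Proof. by move=> Cf; have [] := Cf [::] v w (leqnn _). Qed.

Lemma polytime_id : polytime id.
Proof.
(* The language has no skip; copying a register onto itself replaces it. *)
exists (fun k => Copy (k + 0) (k + 0)), 0, (fun n => n + 1); split; first by polyf.
move=> L v m _; split; first by lia.
apply: runs_copy => //; rewrite ?spaceE; lia.
Qed.

Lemma polytime_leaf : polytime (fun=> Leaf).
Proof.
exists (fun k => SetNil (k + 0)), 0, (fun n => n + 1); split; first by polyf.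
move=> L v m _; split; first by rewrite /=; lia.
apply: runs_nil => //=; rewrite ?spaceE /=; lia.
Qed.

Lemma tree_size_hd t : tree_size (hd t) <= tree_size t.
Proof. by case: t => //= l r; lia. Qed.

Lemma tree_size_tl t : tree_size (tl t) <= tree_size t.
Proof. by case: t => //= l r; lia. Qed.

Lemma polytime_comp f g : polytime f -> polytime g -> polytime (fun v => f (g v)).
Proof.
move=> [cf [wf [pf [Pf Cf]]]] [cg [wg [pg [Pg Cg]]]].
exists (fun k => Seq (cg (k + 0)) (cf (k + 0))), (wf + wg), (fun n => pg n + pf (pg n)).
split; first by polyf.
move=> L v m le_m; have Sf := computes_size (g v) Cf; have Sg := computes_size v Cg.
have Mf := polyf_mono Pf Sg; split; first by lia.
apply: (runs_seq (T1 := pg (tree_size v)) (s2 := L ++ g v :: nseq m Leaf)).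
- by apply: (computes_at (R := [::]) Cg); rewrite ?spaceE; lia.
- by rewrite leq_addr.
- by apply: (computes_at (R := [::]) Cf); rewrite ?spaceE; lia.
Qed.

Lemma polytime_hd f : polytime f -> polytime (fun v => hd (f v)).
Proof.
apply: polytime_comp.
exists (fun k => SetHd (k + 0) (k + 0)), 0, (fun n => n + 1); split; first by polyf.
move=> L v m _; have le_v := tree_size_hd v; split; first by lia.
apply: runs_hd => //; rewrite ?spaceE; lia.
Qed.

Lemma polytime_tl f : polytime f -> polytime (fun v => tl (f v)).
Proof.
apply: polytime_comp.
exists (fun k => SetTl (k + 0) (k + 0)), 0, (fun n => n + 1); split; first by polyf.
move=> L v m _; have le_v := tree_size_tl v; split; first by lia.
apply: runs_tl => //; rewrite ?spaceE; lia.
Qed.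

(** Each call works on its own copy of the argument in a scratch register; both are cleared at the
    end, as [computes] requires. *)
Lemma polytime_node f g : polytime f -> polytime g -> polytime (fun v => Node (f v) (g v)).
Proof.
move=> [cf [wf [pf [Pf Cf]]]] [cg [wg [pg [Pg Cg]]]].
exists (fun k =>
  Seq (Copy (k + 1) (k + 0)) (Seq (cf (k + 1)) (Seq (Copy (k + 2) (k + 0))
  (Seq (cg (k + 2)) (Seq (SetCons (k + 0) (k + 1) (k + 2))
  (Seq (SetNil (k + 1)) (SetNil (k + 2)))))))).
exists (wf + wg).+2, (fun n => 2 * (pf n + pg n + n) + 10); split; first by polyf.
move=> L v [|[|m]] // le_m.
have Sf := computes_size v Cf; have Sg := computes_size v Cg.
split; first by rewrite /=; lia.
apply: (runs_seq (T1 := 1) (s2 := L ++ [:: v, v & nseq m.+1 Leaf])).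
- by apply: runs_copy => //; rewrite ?spaceE; lia.
- by lia.
apply: (runs_seq (T1 := pf (tree_size v)) (s2 := L ++ [:: v, f v & nseq m.+1 Leaf])).
- by apply: (computes_at (R := [:: v]) Cf); rewrite ?spaceE; lia.
- by lia.
apply: (runs_seq (T1 := 1) (s2 := L ++ [:: v, f v, v & nseq m Leaf])).
- by apply: runs_copy => //; rewrite ?spaceE; lia.
- by lia.
apply: (runs_seq (T1 := pg (tree_size v)) (s2 := L ++ [:: v, f v, g v & nseq m Leaf])).
- by apply: (computes_at (R := [:: v; f v]) Cg); rewrite ?spaceE; lia.
- by lia.
apply: (runs_seq (T1 := 1) (s2 := L ++ [:: Node (f v) (g v), f v, g v & nseq m Leaf])).
- by apply: runs_cons => //; rewrite ?spaceE /=; lia.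
- by lia.
apply: (runs_seq (T1 := 1) (s2 := L ++ [:: Node (f v) (g v), Leaf, g v & nseq m Leaf])).
- by apply: runs_nil => //; rewrite ?spaceE /=; lia.
- by lia.
by apply: runs_nil => //; rewrite ?spaceE /=; lia.
Qed.

Lemma runs_if L R i c1 c2 s' T B : space (L ++ R) <= B -> 0 < T ->
  runs (if read R i is Node _ _ then c1 else c2) (L ++ R) s' T.-1 B ->
  runs (If (size L + i) c1 c2) (L ++ R) s' T B.
Proof.
move=> HB HT [tr [ex sz atr]]; exists (tick (L ++ R) :: tr); split.
- case: (read R i) (read_cat L R i) ex => [|l r] E ex.
    exact: ExecIfFalse.
  by apply: ExecIfTrue => //; rewrite E.
- by rewrite /=; lia.
- by rewrite /= HB.
Qed.

Lemma polytime_if f g h : polytime f -> polytime g -> polytime h ->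
  polytime (fun v => if f v is Node _ _ then g v else h v).
Proof.
move=> [cf [wf [pf [Pf Cf]]]] [cg [wg [pg [Pg Cg]]]] [ch [wh [ph [Ph Ch]]]].
exists (fun k =>
  Seq (Copy (k + 1) (k + 0)) (Seq (cf (k + 1))
  (If (k + 1) (Seq (SetNil (k + 1)) (cg (k + 0))) (ch (k + 0))))).
exists (wf + wg + wh).+1, (fun n => 2 * n + pf n + pg n + ph n + 5); split; first by polyf.
move=> L v [|m] // le_m.
have Sf := computes_size v Cf; have Sg := computes_size v Cg; have Sh := computes_size v Ch.
split; first by case: (f v) => *; lia.
apply: (runs_seq (T1 := 1) (s2 := L ++ [:: v, v & nseq m Leaf])).
- by apply: runs_copy => //; rewrite ?spaceE; lia.
- by lia.
apply: (runs_seq (T1 := pf (tree_size v)) (s2 := L ++ [:: v, f v & nseq m Leaf])).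
- by apply: (computes_at (R := [:: v]) Cf); rewrite ?spaceE; lia.
- by lia.
apply: runs_if; rewrite ?spaceE; [lia | lia |].
rewrite {1}/read [nth _ _ _]/=; case: (f v) Sf => [|l r] Sf.
  (* Here the tested register is already [Leaf]; only the other branch has to clear it. *)
  by apply: (computes_at (R := [::]) (m := m.+1) Ch); rewrite ?spaceE; lia.
apply: (runs_seq (T1 := 1) (s2 := L ++ [:: v, Leaf & nseq m Leaf])).
- by apply: runs_nil => //; rewrite ?spaceE /=; lia.
- by lia.
by apply: (computes_at (R := [::]) (m := m.+1) Cg); rewrite ?spaceE; lia.
Qed.

(** * Folds over lists encoded as trees *)

Definition elems := fix elems (t : tree) : seq tree :=
  if t is Node x l then x :: elems l else [::].

Definition fold_step (g : tree -> tree) (e a x : tree) := g (Node e (Node x a)).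

Definition foldt (g : tree -> tree) (e l a : tree) : tree :=
  foldl (fold_step g e) a (elems l).

(** The growth of the accumulator must not depend on its size: a step that doubles it would reach
    exponential size when iterated. *)
Definition additive (g : tree -> tree) : Prop := exists q, polyf q /\ forall e x a,
  tree_size (g (Node e (Node x a))) <= tree_size a + q (tree_size e + tree_size x).

Lemma foldt_size g e Q n l a :
  (forall x b, tree_size x <= n -> tree_size (g (Node e (Node x b))) <= tree_size b + Q) ->
  tree_size l <= n -> tree_size (foldt g e l a) <= tree_size a + tree_size l * Q.
Proof.
rewrite /foldt => Hg; elim: l a => [|x _ l IHl] a /= le_l; first by lia.
apply: leq_trans (IHl _ _) _; first by lia.
have := Hg x a; rewrite /fold_step; lia.
Qed.

(** The loop state is [Node l (Node e a)]: remaining list, environment, accumulator. As a function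
    of one tree, the loop body is compiled by the combinators. *)
Definition loop_step (g : tree -> tree) (u : tree) : tree :=
  Node (tl (hd u)) (Node (hd (tl u)) (g (Node (hd (tl u)) (Node (hd (hd u)) (tl (tl u)))))).

Lemma polytime_loop_step g : polytime g -> polytime (loop_step g).
Proof.
move=> Pg; have Pid := polytime_id.
apply: polytime_node; first by do 2!(apply: polytime_tl || apply: polytime_hd).
apply: polytime_node; first by apply: polytime_hd; apply: polytime_tl.
apply: (polytime_comp Pg); apply: polytime_node; first by apply: polytime_hd; apply: polytime_tl.
by apply: polytime_node; [do 2!apply: polytime_hd | do 2!apply: polytime_tl].
Qed.

Lemma runs_while_true T1 L R i l r c s1 s2 T B : read R i = Node l r ->
  space (L ++ R) <= B ->
  runs c (L ++ R) s1 T1 B -> T1 < T -> runs (While (size L + i) c) s1 s2 (T - T1.+1) B ->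
  runs (While (size L + i) c) (L ++ R) s2 T B.
Proof.
move=> E HB [t1 [e1 z1 a1]] ltT [t2 [e2 z2 a2]].
exists (tick (L ++ R) :: t1 ++ t2); split.
- by apply: ExecWhileTrue e1 e2; rewrite read_cat E.
- by rewrite /= size_cat; lia.
- by rewrite /= HB all_cat a1.
Qed.

Lemma runs_while_false L R i c T B : read R i = Leaf ->
  space (L ++ R) <= B -> 0 < T -> runs (While (size L + i) c) (L ++ R) (L ++ R) T B.
Proof.
move=> E HB HT; exists [:: tick (L ++ R)]; split=> //=; last by rewrite HB.
by apply: ExecWhileFalse; rewrite read_cat.
Qed.

(** Register [k + 1] holds a copy of the remaining list as loop test. It is cleared before the body,
    which expects empty scratch registers, and reloaded after it. *)
Definition fold_loop (c : nat -> program) (k : nat) : program :=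
  While (k + 1) (Seq (SetNil (k + 1)) (Seq (c (k + 0)) (SetHd (k + 1) (k + 0)))).

(** Consuming an item lowers [tree_size l * Q] by at least the [Q] that the accumulator may gain.
    The sum bounded by [N] thus never grows, and an iteration costs at most [p N + 3] steps. *)
Lemma runs_fold_loop g c w p e Q l0 N L m :
  computes (loop_step g) c w p -> polyf p -> w <= m.+1 ->
  (forall x a, tree_size x <= l0 -> tree_size (g (Node e (Node x a))) <= tree_size a + Q) ->
  forall l a, tree_size l <= l0 ->
  tree_size a + tree_size l * Q + tree_size l + tree_size e + 2 <= N ->
  runs (fold_loop c (size L)) (L ++ [:: Node l (Node e a), l & nseq m Leaf])
    (L ++ [:: Node Leaf (Node e (foldt g e l a)), Leaf & nseq m Leaf])
    (tree_size l * (p N + 3)) (space L + m + 2 * N + p N).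
Proof.
move=> Cc Pp le_m Hg; elim=> [|x _ l IHl] a le_l le_N.
  apply: runs_while_false => //; rewrite ?spaceE /=; lia.
rewrite /= in le_l le_N; have le_x := Hg x a ltac:(lia).
set u := Node (Node x l) (Node e a).
pose u' := Node l (Node e (g (Node e (Node x a)))).
have le_u : tree_size u <= N by rewrite /=; lia.
have le_pu := polyf_mono Pp le_u.
have le_u' : tree_size u' <= N.
  by rewrite /=; nia.
apply: (runs_while_true (T1 := p N + 2) (s1 := L ++ [:: u', l & nseq m Leaf])) => //=.
- by rewrite ?spaceE /=; lia.
- apply: (runs_seq (T1 := 1) (s2 := L ++ [:: u, Leaf & nseq m Leaf])).
  + by apply: runs_nil => //; rewrite ?spaceE /=; lia.
  + by lia.
  apply: (runs_seq (T1 := p N) (s2 := L ++ [:: u', Leaf & nseq m Leaf])).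
  + by apply: (computes_at (R := [::]) (m := m.+1) Cc); rewrite ?spaceE; lia.
  + by lia.
  by apply: runs_hd => //; rewrite ?spaceE /= in le_u' *; lia.
- by lia.
apply: runs_le (IHl _ _ _); [nia | by [] | lia |].
rewrite /fold_step; nia.
Qed.

Lemma polytime_foldt g e l a : polytime g -> additive g ->
  polytime e -> polytime l -> polytime a -> polytime (fun v => foldt g (e v) (l v) (a v)).
Proof.
move=> Pg [q [Pq Hq]] Pe Pl Pa.
have [c [w [p [Pp Cc]]]] := polytime_loop_step Pg.
pose u v := Node (l v) (Node (e v) (a v)).
have [cu [wu [pu [Pu Cu]]]] : polytime u by do 2!apply: polytime_node => //.
(* The loop ends with the accumulator still inside its state; it is extracted afterwards by
   composition. *)
pose h v := Node Leaf (Node (e v) (foldt g (e v) (l v) (a v))).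
suff Ph : polytime h.
  by apply: (@polytime_comp (fun v => tl (tl v)) h) => //; do 2!apply: polytime_tl;
    apply: polytime_id.
(* When [n] bounds the initial state, [N n] bounds all later ones. *)
pose N n := n + n * q n.
exists (fun k => Seq (cu (k + 0)) (Seq (SetHd (k + 1) (k + 0)) (fold_loop c k))), (wu + w).+2.
exists (fun n => pu n + 1 + pu n * (p (N (pu n)) + 3) + 2 * N (pu n) + p (N (pu n))).
split; first by rewrite /N; polyf.
move=> L v [|m] // le_m; set n := pu (tree_size v).
have le_u : tree_size (u v) <= n := computes_size v Cu.
have {}Hq x b : tree_size x <= tree_size (l v) ->
    tree_size (g (Node (e v) (Node x b))) <= tree_size b + q n.
  move=> le_x; apply: leq_trans (Hq _ _ _) _; rewrite leq_add2l.
  by apply: (polyf_mono Pq); move: le_u; rewrite /=; lia.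
have sz_fold : tree_size (foldt g (e v) (l v) (a v)) <= tree_size (a v) + tree_size (l v) * q n.
  exact: foldt_size Hq (leqnn _).
have le_N : tree_size (a v) + tree_size (l v) * q n + tree_size (l v) + tree_size (e v) + 2 <= N n.
  by move: le_u; rewrite /N /=; nia.
split; first by rewrite /h /=; lia.
apply: (runs_seq (T1 := n) (s2 := L ++ [:: u v, Leaf & nseq m Leaf])).
- by apply: (computes_at (R := [::]) (m := m.+1) Cu); rewrite ?spaceE -/n; lia.
- by lia.
apply: (runs_seq (T1 := 1) (s2 := L ++ [:: u v, l v & nseq m Leaf])).
- by apply: runs_hd => //; rewrite ?spaceE /= in le_u *; lia.
- by lia.
have le_w : w <= m.+1 by lia.
apply: runs_le (runs_fold_loop L Cc Pp le_w Hq (leqnn _) le_N); last by lia.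
by move: le_u; rewrite /=; nia.
Qed.

(** * One step of the search, on trees *)

Definition cond (c a b : tree) : tree := if c is Node _ _ then a else b.

(** A hook, rebound below as further tree functions become available. *)
Ltac polytime_call := fail.

Ltac polytime :=
  first [assumption |
  lazymatch goal with
  | |- polytime (fun v => v) => exact: polytime_id
  | |- polytime (fun=> Leaf) => exact: polytime_leaf
  | |- polytime (fun v => Node (@?f v) (@?g v)) => apply: (@polytime_node f g); polytime
  | |- polytime (fun v => hd (@?f v)) => apply: (@polytime_hd f); polytime
  | |- polytime (fun v => tl (@?f v)) => apply: (@polytime_tl f); polytime
  | |- polytime (fun v => cond (@?f v) (@?g v) (@?h v)) =>
      apply: (@polytime_if f g h); polytime
  | |- polytime _ => polytime_call; polytime
  end].

Lemma tree_size_cond c a b : tree_size (cond c a b) <= maxn (tree_size a) (tree_size b).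
Proof. by case: c => /=; lia. Qed.

Lemma condE b t1 t2 : cond (enc_bool b) t1 t2 = if b then t1 else t2.
Proof. by case: b. Qed.

Lemma cond_bool b1 b2 : cond (enc_bool b1) (enc_bool b2) Leaf = enc_bool (b1 && b2).
Proof. by case: b1. Qed.

(* The function folded by [foldt] receives [Node env (Node item acc)]. *)
Local Notation env v := (hd v).
Local Notation item v := (hd (tl v)).
Local Notation acc v := (tl (tl v)).
Local Notation tru := (Node Leaf Leaf).

Definition revt (l : tree) : tree := foldt (fun v => Node (item v) (acc v)) Leaf l Leaf.

(** The accumulator pairs the unread bits of the second vector with the output so far, which is
    reversed; hence the final [revt]. *)
Definition union_step v :=
  Node (tl (hd (acc v)))
    (Node (cond (item v) tru (cond (hd (hd (acc v))) tru Leaf)) (tl (acc v))).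
Definition uniont (a b : tree) : tree :=
  revt (tl (foldt union_step Leaf a (Node b Leaf))).

(** Here and in the next tests, the accumulator pairs the unread bits of a vector with a flag, reset
    to [Leaf] at a violation. *)
Definition subset_step v :=
  Node (tl (hd (acc v)))
    (cond (item v) (cond (hd (hd (acc v))) (tl (acc v)) Leaf) (tl (acc v))).
Definition subsett (a b : tree) : tree := tl (foldt subset_step Leaf a (Node b tru)).

Definition disj_step v :=
  Node (tl (hd (acc v)))
    (cond (item v) (cond (hd (hd (acc v))) Leaf (tl (acc v))) (tl (acc v))).
Definition disjt (a b : tree) : tree := tl (foldt disj_step Leaf a (Node b tru)).

Definition eqt (a b : tree) : tree := cond (subsett a b) (subsett b a) Leaf.

(** [S] is used twice: read bit by bit to select the rows of its members, and as environment to be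
    disjoint from those rows. *)
Definition cf_step v :=
  Node (tl (hd (acc v)))
    (cond (hd (hd (acc v))) (cond (disjt (item v) (env v)) (tl (acc v)) Leaf) (tl (acc v))).
Definition cft (M S : tree) : tree := tl (foldt cf_step S M (Node S tru)).

(** From here to [childrent], the tree functions mirror [greedy], [cand], [below], [legal_cand] and
    [children] on encodings. *)
Definition greedy_step v :=
  cond (cft (env v) (uniont (item v) (acc v))) (uniont (item v) (acc v)) (acc v).
Definition greedyt (M L S : tree) : tree := foldt greedy_step M L S.

Definition cand_step v :=
  cond (subsett (item v) (tl (tl (env v))))
    (cond (cft (hd (env v)) (uniont (item v) (hd (tl (env v)))))
       (uniont (item v) (acc v)) (acc v))
    (acc v).
Definition candt (M L I S : tree) : tree := foldt cand_step (Node M (Node I S)) L I.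

(** The vector of the empty set, its length taken from any list indexed by the arguments. *)
Definition zerot (t : tree) : tree := foldt (fun v => Node Leaf (acc v)) Leaf t Leaf.

Definition below_step v := cond (subsett (item v) (env v)) (uniont (item v) (acc v)) (acc v).
Definition belowt (L S : tree) : tree := foldt below_step S L (zerot S).

Definition testt (M L S C : tree) : tree :=
  cond (cft M C) (cond (eqt (greedyt M L C) C) (eqt (greedyt M L (belowt L C)) S) Leaf) Leaf.

(** A search node: members already treated, latest first, members to come, current union. *)
Definition node (L R S : tree) : tree := Node L (Node R S).

Definition childrent (M L I R S st : tree) : tree :=
  cond (cft M (uniont I S)) (Node (node (Node I L) R (uniont I S)) st)
    (cond (testt M L S (candt M L I S))
       (Node (node (Node I L) R S) (Node (node (Node I L) R (candt M L I S)) st))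
       (Node (node (Node I L) R S) st)).

(** The result pairs an optional output with the next state. An output is wrapped in a [Node], since
    the vector over no arguments is itself [Leaf]. *)
Definition expandt (M L R S st : tree) : tree :=
  cond R (Node Leaf (Node (childrent M L (hd R) (tl R) S st) M))
    (Node (Node S Leaf) (Node st M)).

Definition stept (u : tree) : tree :=
  expandt (tl u) (hd (hd (hd u))) (hd (tl (hd (hd u)))) (tl (tl (hd (hd u)))) (tl (hd u)).

Definition initt (v : tree) : tree :=
  Node (Node (node Leaf (tl v) (zerot (hd v))) Leaf) (hd v).

(** * The step takes polynomial time *)

Lemma polytime_revt f : polytime f -> polytime (fun v => revt (f v)).
Proof.
move=> Pf; apply: polytime_foldt; try polytime.
by exists (fun n => n + 1); split; [polyf | move=> e x a /=; lia].
Qed.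

Ltac step_additive := exists (fun n => n + 10); split; first by polyf.

Lemma union_step_additive : additive union_step.
Proof.
step_additive => e x a; rewrite /union_step /=.
have le_a : tree_size (tl (hd a)) + tree_size (tl a) <= tree_size a + 1.
  by case: a => //= l r; have := tree_size_tl l; lia.
have := tree_size_cond (hd (hd a)) tru Leaf.
have := tree_size_cond x tru (cond (hd (hd a)) tru Leaf); rewrite /=; lia.
Qed.

Lemma polytime_union_step : polytime union_step.
Proof. by rewrite /union_step; polytime. Qed.

Lemma polytime_uniont f g : polytime f -> polytime g -> polytime (fun v => uniont (f v) (g v)).
Proof.
move=> Pf Pg; apply/polytime_revt/polytime_tl; apply: polytime_foldt => //.
- exact: polytime_union_step.
- exact: union_step_additive.
- exact: polytime_leaf.
- by apply: polytime_node => //; apply: polytime_leaf.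
Qed.

Lemma zip_step_size a t : tree_size t <= maxn 1 (tree_size (tl a)) ->
  tree_size (Node (tl (hd a)) t) <= tree_size a + 10.
Proof.
case: a => //= [|l r]; first by lia.
have := tree_size_tl l; have := tree_size_gt0 r; lia.
Qed.

Ltac polytime_call ::=
  lazymatch goal with
  | |- polytime (fun v => uniont (@?f v) (@?g v)) => apply: (@polytime_uniont f g)
  end.

Lemma polytime_subsett f g : polytime f -> polytime g -> polytime (fun v => subsett (f v) (g v)).
Proof.
move=> Pf Pg; apply/polytime_tl; apply: polytime_foldt => //.
- by rewrite /subset_step; polytime.
- step_additive => e x a; apply: (leq_trans (zip_step_size _)) => /=; last by lia.
  by case: x => [|? ?]; case: (hd (hd a)) => [|? ?] /=; lia.
- exact: polytime_leaf.
- by apply: polytime_node => //; polytime.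
Qed.

Lemma polytime_disjt f g : polytime f -> polytime g -> polytime (fun v => disjt (f v) (g v)).
Proof.
move=> Pf Pg; apply/polytime_tl; apply: polytime_foldt => //.
- by rewrite /disj_step; polytime.
- step_additive => e x a; apply: (leq_trans (zip_step_size _)) => /=; last by lia.
  by case: x => [|? ?]; case: (hd (hd a)) => [|? ?] /=; lia.
- exact: polytime_leaf.
- by apply: polytime_node => //; polytime.
Qed.

Ltac polytime_call ::=
  lazymatch goal with
  | |- polytime (fun v => uniont (@?f v) (@?g v)) => apply: (@polytime_uniont f g)
  | |- polytime (fun v => subsett (@?f v) (@?g v)) => apply: (@polytime_subsett f g)
  | |- polytime (fun v => disjt (@?f v) (@?g v)) => apply: (@polytime_disjt f g)
  end.

Lemma polytime_eqt f g : polytime f -> polytime g -> polytime (fun v => eqt (f v) (g v)).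
Proof. by move=> Pf Pg; rewrite /eqt; polytime. Qed.

Lemma polytime_cft f g : polytime f -> polytime g -> polytime (fun v => cft (f v) (g v)).
Proof.
move=> Pf Pg; apply/polytime_tl; apply: polytime_foldt => //.
- by rewrite /cf_step; polytime.
- step_additive => e x a; apply: (leq_trans (zip_step_size _)) => /=; last by lia.
  by case: (disjt _ _) => [|? ?]; case: (hd (hd a)) => [|? ?] /=; lia.
- by apply: polytime_node => //; polytime.
Qed.

(** [additive] ranges over all trees, so [uniont] must be described on arguments that encode no set
    as well. *)
Fixpoint or_bits (l : seq tree) (b : tree) : seq bool :=
  if l is x :: l' then (if cond x tru (hd b) is Node _ _ then true else false) :: or_bits l' (tl b)
  else [::].

Lemma size_or_bits l b : size (or_bits l b) = size l.
Proof. by elim: l b => //= x l IHl b; rewrite IHl. Qed.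

Lemma elems_enc_seq (T : Type) (enc : T -> tree) s : elems (enc_seq enc s) = map enc s.
Proof. by elim: s => //= x s ->. Qed.

Lemma foldt_enc (T U : Type) (enc : T -> tree) (ea : U -> tree) (h : U -> T -> U) g e :
  (forall u x, g (Node e (Node (enc x) (ea u))) = ea (h u x)) ->
  forall l u, foldt g e (enc_seq enc l) (ea u) = ea (foldl h u l).
Proof.
move=> Hg l u; rewrite /foldt elems_enc_seq; elim: l u => //= x l IHl u.
by rewrite /fold_step Hg IHl.
Qed.

Lemma revt_enc (T : Type) (enc : T -> tree) l : revt (enc_seq enc l) = enc_seq enc (rev l).
Proof.
rewrite /revt (foldt_enc (ea := enc_seq enc) (h := fun s x => x :: s) _ l [::]) //.
congr enc_seq; rewrite /rev; elim: l [::] => //= x l IHl s; exact: IHl.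
Qed.

Lemma uniontE a b : uniont a b = enc_seq enc_bool (or_bits (elems a) b).
Proof.
rewrite /uniont /foldt; set l := elems a.
suff H out : tl (foldl (fold_step union_step Leaf) (Node b (enc_seq enc_bool out)) l) =
    enc_seq enc_bool (catrev (or_bits l b) out).
  by rewrite (H [::]) revt_enc catrevE cats0 revK.
elim: l b out => //= x l IHl b out; rewrite -IHl; congr (tl (foldl _ _ _)).
by rewrite /fold_step /union_step /=; case: x => [|? ?]; case: (hd b) => [|? ?].
Qed.

(** The result has one bit per entry of [a], whatever [b] is. Putting the item first and the
    accumulator second therefore makes folds of unions additive. *)
Lemma uniont_size a b : tree_size (uniont a b) <= 4 * tree_size a.
Proof.
rewrite uniontE; have : size (or_bits (elems a) b) < tree_size a.
  by rewrite size_or_bits; elim: a => //= x _ l IHl; lia.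
elim: (or_bits _ _) (tree_size a) => //= [|x s IHs] n; first by lia.
case: n => // n lt_n; have := IHs n lt_n; case: x => /=; lia.
Qed.

Ltac polytime_call ::=
  lazymatch goal with
  | |- polytime (fun v => uniont (@?f v) (@?g v)) => apply: (@polytime_uniont f g)
  | |- polytime (fun v => subsett (@?f v) (@?g v)) => apply: (@polytime_subsett f g)
  | |- polytime (fun v => eqt (@?f v) (@?g v)) => apply: (@polytime_eqt f g)
  | |- polytime (fun v => cft (@?f v) (@?g v)) => apply: (@polytime_cft f g)
  end.

Lemma polytime_greedyt f g h : polytime f -> polytime g -> polytime h ->
  polytime (fun v => greedyt (f v) (g v) (h v)).
Proof.
move=> Pf Pg Ph; apply: polytime_foldt => //; first by rewrite /greedy_step; polytime.
exists (fun n => 4 * n); split; first by polyf.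
move=> e x a; apply: (leq_trans (tree_size_cond _ _ _)) => /=.
by have := uniont_size x a; lia.
Qed.

Lemma polytime_candt f g h k : polytime f -> polytime g -> polytime h -> polytime k ->
  polytime (fun v => candt (f v) (g v) (h v) (k v)).
Proof.
move=> Pf Pg Ph Pk; apply: polytime_foldt => //; first by rewrite /cand_step; polytime.
  exists (fun n => 4 * n); split; first by polyf.
  move=> e x a; apply: (leq_trans (tree_size_cond _ _ _)) => /=.
  rewrite geq_max; apply/andP; split; last by lia.
  apply: (leq_trans (tree_size_cond _ _ _)) => /=.
  by have := uniont_size x a; lia.
by do 2!apply: polytime_node => //.
Qed.

Lemma polytime_zerot f : polytime f -> polytime (fun v => zerot (f v)).
Proof.
move=> Pf; apply: polytime_foldt => //; try polytime.
by step_additive => e x a /=; lia.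
Qed.

Lemma polytime_belowt f g : polytime f -> polytime g -> polytime (fun v => belowt (f v) (g v)).
Proof.
move=> Pf Pg; apply: polytime_foldt => //; first by rewrite /below_step; polytime.
  exists (fun n => 4 * n); split; first by polyf.
  move=> e x a; apply: (leq_trans (tree_size_cond _ _ _)) => /=.
  by have := uniont_size x a; lia.
exact: polytime_zerot.
Qed.

Ltac polytime_call ::=
  lazymatch goal with
  | |- polytime (fun v => uniont (@?f v) (@?g v)) => apply: (@polytime_uniont f g)
  | |- polytime (fun v => eqt (@?f v) (@?g v)) => apply: (@polytime_eqt f g)
  | |- polytime (fun v => cft (@?f v) (@?g v)) => apply: (@polytime_cft f g)
  | |- polytime (fun v => greedyt (@?f v) (@?g v) (@?h v)) => apply: (@polytime_greedyt f g h)
  | |- polytime (fun v => candt (@?f v) (@?g v) (@?h v) (@?k v)) =>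
      apply: (@polytime_candt f g h k)
  | |- polytime (fun v => zerot (@?f v)) => apply: (@polytime_zerot f)
  | |- polytime (fun v => belowt (@?f v) (@?g v)) => apply: (@polytime_belowt f g)
  end.

Lemma polytime_stept : polytime stept.
Proof. by rewrite /stept /expandt /childrent /testt /node; polytime. Qed.

Lemma polytime_initt : polytime initt.
Proof. by rewrite /initt /node; polytime. Qed.

(** * The search tree *)

Section MaximalUnions.
Variables (A : finType) (cf : pred {set A}).
Hypothesis cf0 : cf set0.
Hypothesis cf_sub : forall S T : {set A}, S \subset T -> cf T -> cf S.
(** All that the search uses of conflict-freeness being a condition on pairs. *)
Hypothesis cfU3 : forall S T U : {set A},
  cf (S :|: T) -> cf (S :|: U) -> cf (T :|: U) -> cf (S :|: T :|: U).
Implicit Types (S T I J C : {set A}) (L R : seq {set A}).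

Definition greedy L S := foldl (fun S J => if cf (J :|: S) then J :|: S else S) S L.
Definition cand L I S :=
  foldl (fun C J => if (J \subset S) && cf (J :|: I) then J :|: C else C) I L.
Definition below L S := foldl (fun T J => if J \subset S then J :|: T else T) set0 L.
Definition legal_cand L S C := [&& cf C, greedy L C == C & greedy L (below L C) == S].

Definition children L I S :=
  if cf (I :|: S) then [:: I :|: S]
  else if legal_cand L S (cand L I S) then [:: S; cand L I S] else [:: S].

Fixpoint leaves L R S :=
  if R is K :: R' then flatten [seq leaves (K :: L) R' S' | S' <- children L K S] else [:: S].

(** As [cf] passes to subsets, testing single members amounts to maximality among all conflict-free
    unions of members. *)
Definition max_union L S : Prop :=
  [/\ cf S, S \subset \bigcup_(J <- L | J \subset S) J &
      forall J, J \in L -> cf (J :|: S) -> J \subset S].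

Lemma bigcup_seqP L (P : pred {set A}) x :
  reflect (exists J, [/\ J \in L, P J & x \in J]) (x \in \bigcup_(J <- L | P J) J).
Proof.
elim: L => [|J L IHL]; first by rewrite big_nil inE; constructor => -[? []].
rewrite big_cons; case: ifP => PJ; last first.
  apply: (iffP IHL) => -[K [LK PK Kx]]; exists K; split=> //; first by rewrite inE LK orbT.
  by move: LK PK; rewrite inE => /predU1P[->|//]; rewrite PJ.
rewrite inE; apply: (iffP orP) => [[Jx|/IHL[K [LK PK Kx]]]|[K []]].
- by exists J; rewrite inE eqxx.
- by exists K; rewrite inE LK orbT.
rewrite inE => /predU1P[->|LK] PK Kx; first by left.
by right; apply/IHL; exists K.
Qed.

Lemma fold_union (P : pred {set A}) L T :
  foldl (fun T J => if P J then J :|: T else T) T L = T :|: \bigcup_(J <- L | P J) J.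
Proof.
elim: L T => [|J L IHL] T /=; first by rewrite big_nil setU0.
by rewrite IHL big_cons; case: (P J) => //; rewrite -setUA setUCA.
Qed.

Lemma belowP L S x : reflect (exists J, [/\ J \in L, J \subset S & x \in J]) (x \in below L S).
Proof. by rewrite /below fold_union set0U; apply: bigcup_seqP. Qed.

Lemma candE L I S :
  cand L I S = I :|: \bigcup_(J <- L | (J \subset S) && cf (J :|: I)) J.
Proof. exact: fold_union. Qed.

Lemma below_subset L S : below L S \subset S.
Proof. by apply/subsetP => x /belowP[J [_ /subsetP JS /JS]]. Qed.

Lemma sub_below L S J : J \in L -> J \subset S -> J \subset below L S.
Proof. by move=> LJ JS; apply/subsetP => x Jx; apply/belowP; exists J. Qed.

Lemma max_unionP L S :
  max_union L S <->
  [/\ cf S, below L S = S & forall J, J \in L -> cf (J :|: S) -> J \subset S].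
Proof.
split=> -[cfS E maxS]; split=> //.
  apply/eqP; rewrite eqEsubset below_subset; apply: subset_trans E _.
  by rewrite /below fold_union set0U.
by rewrite -{1}E /below fold_union set0U.
Qed.

Lemma greedy_sub L S : S \subset greedy L S.
Proof.
elim: L S => //= J L IHL S; apply: subset_trans (IHL _).
by case: ifP => // _; apply: subsetUr.
Qed.

Lemma greedy_cf L S : cf S -> cf (greedy L S).
Proof. by elim: L S => //= J L IHL S cfS; apply: IHL; case: ifP. Qed.

(** A rejected member conflicts with the set held at that moment, hence with the larger final
    one. *)
Lemma greedy_max L S J : J \in L -> cf (J :|: greedy L S) -> J \subset greedy L S.
Proof.
elim: L S => //= K L IHL S; rewrite inE => /predU1P[->|]; last exact: IHL.
have := greedy_sub L (if cf (K :|: S) then K :|: S else S).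
case: ifP => [_ sub _|ncf sub cfK].
  by apply: subset_trans sub; apply: subsetUl.
by rewrite (cf_sub _ cfK) // setUS // in ncf.
Qed.

Lemma greedy_id L S : (forall J, J \in L -> cf (J :|: S) -> J \subset S) -> greedy L S = S.
Proof.
elim: L => //= J L IHL maxS; rewrite (_ : (if _ then _ else _) = S).
  by apply: IHL => K LK; apply: maxS; rewrite inE LK orbT.
by case: ifP => // /(maxS _ (mem_head _ _))/setUidPr.
Qed.

(** [L'] stays fixed while the induction consumes [L]. *)
Lemma greedy_union L L' S :
  (forall x, x \in S -> exists J, [/\ J \in L', J \subset S & x \in J]) ->
  {subset L <= L'} -> forall x, x \in greedy L S ->
  exists J, [/\ J \in L', J \subset greedy L S & x \in J].
Proof.
elim: L S => //= K L IHL S HS LL'; apply: IHL; last first.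
  by move=> J LJ; apply: LL'; rewrite inE LJ orbT.
case: ifP => // _ x; rewrite inE => /orP[Kx|/HS[J [L'J JS Jx]]].
  by exists K; rewrite LL' ?mem_head ?subsetUl.
by exists J; rewrite L'J Jx (subset_trans JS) ?subsetUr.
Qed.

Lemma greedy_max_union L S : cf S -> max_union L (greedy L (below L S)).
Proof.
move=> cfS; have cfB : cf (below L S) := cf_sub (below_subset L S) cfS.
split; [exact: greedy_cf | | exact: greedy_max].
apply/subsetP => x Hx; apply/bigcup_seqP.
apply: (greedy_union (L' := L)) Hx => // y /belowP[J [LJ JS Jy]].
by exists J; rewrite LJ Jy sub_below.
Qed.

Lemma max_union_cons L I S : max_union L S ->
  max_union (I :: L) (if cf (I :|: S) then I :|: S else S).
Proof.
move=> /max_unionP[cfS ES maxS]; have memS x : x \in S -> exists J, [/\ J \in L, J \subset S & x \in J].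
  by rewrite -{1}ES => /belowP.
case: ifP => cfIS; split=> //.
- apply/subsetP => x; rewrite inE => Hx; apply/bigcup_seqP.
  case/orP: Hx => [Ix|/memS[J [LJ JS Jx]]]; first by exists I; rewrite mem_head subsetUl.
  by exists J; rewrite inE LJ orbT (subset_trans JS) ?subsetUr.
- move=> J; rewrite inE => /predU1P[->|LJ] cfJ; first exact: subsetUl.
  apply: subset_trans (subsetUr I S); apply: maxS => //.
  by apply: cf_sub cfJ; rewrite setUS ?subsetUr.
- apply/subsetP => x /memS[J [LJ JS Jx]]; apply/bigcup_seqP.
  by exists J; rewrite inE LJ orbT.
- by move=> J; rewrite inE => /predU1P[->|/maxS //]; rewrite cfIS.
Qed.

Definition parent L I S' := if I \subset S' then greedy L (below L S') else S'.

(** Distinct nodes share no child. For [I :|: S], a member inside it is compatible with [S], so lies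
    in [S] by maximality; for [cand], the equation is the last test of [legal_cand]. *)
Lemma children_parent L I S S' : max_union L S -> S' \in children L I S -> parent L I S' = S.
Proof.
move=> /max_unionP[cfS ES maxS]; rewrite /children /parent.
case: ifP => [cfIS|ncf].
  rewrite inE => /eqP->; rewrite subsetUl (_ : below L (I :|: S) = S) ?greedy_id //.
  apply/eqP; rewrite eqEsubset; apply/andP; split.
    apply/subsetP => x /belowP[J [LJ JIS Jx]]; apply: (subsetP (maxS J LJ _)) => //.
    by apply: cf_sub cfIS; rewrite subUset JIS subsetUr.
  apply/subsetP => x; rewrite -{1}ES => /belowP[J [LJ JS Jx]]; apply/belowP.
  by exists J; rewrite LJ (subset_trans JS) ?subsetUr.
have nIS : I \subset S = false.
  by apply: contraFF ncf => /setUidPr ->.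
case: ifP => [/and3P[_ _ /eqP EC]|_]; rewrite !inE; last by move=> /eqP->; rewrite nIS.
by case/orP=> /eqP->; rewrite ?nIS // candE subsetUl -candE.
Qed.

Lemma children_uniq L I S : cf S -> uniq (children L I S).
Proof.
move=> cfS; rewrite /children; case: ifP => // ncf; case: ifP => //= _; rewrite inE andbT.
apply: contraFneq ncf => E; suff /setUidPr-> : I \subset S by [].
by rewrite E candE subsetUl.
Qed.

Lemma children_max_union L I S S' :
  max_union L S -> S' \in children L I S -> max_union (I :: L) S'.
Proof.
move=> HS; have := max_union_cons I HS; rewrite /children.
case: ifP => _ HS'; first by rewrite inE => /eqP->.
case: ifP => [/and3P[cfC /eqP maxC _]|_]; last by rewrite inE => /eqP->.
rewrite !inE => /orP[/eqP->//|/eqP->]; split=> //.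
- apply/subsetP => x; rewrite {1}candE inE => Hx; apply/bigcup_seqP.
  case/orP: Hx => [Ix|/bigcup_seqP[J [LJ PJ Jx]]].
    by exists I; rewrite mem_head candE subsetUl.
  exists J; rewrite inE LJ orbT; split=> //; rewrite candE.
  by apply/subsetP => y Jy; rewrite inE; apply/orP; right; apply/bigcup_seqP; exists J.
- move=> J; rewrite inE => /predU1P[->|LJ]; first by rewrite candE subsetUl.
  by have := @greedy_max L (cand L I S) J LJ; rewrite maxC.
Qed.

Lemma parent_max_union L I S' : max_union (I :: L) S' -> max_union L (parent L I S').
Proof.
move=> [cfS' ES' maxS']; rewrite /parent; case: ifPn => [_|nIS']; first exact: greedy_max_union.
split=> // [|J LJ]; last by apply: maxS'; rewrite inE LJ orbT.
by move: ES'; rewrite big_cons (negPf nIS').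
Qed.

(** No maximal union is missed. If [I] is not inside [S'], then [S'] is its own parent and conflicts
    with [I]. Otherwise [S'] is [I :|: T], and it equals [I :|: P] or [cand L I P] for its parent
    [P]. *)
Lemma mem_children_parent L I S' :
  max_union (I :: L) S' -> S' \in children L I (parent L I S').
Proof.
move=> HS'; have := parent_max_union HS'; have [cfS' ES' maxS'] := HS'.
rewrite /parent; case: ifPn => [IS'|nIS'] HS; last first.
  rewrite /children ifF; last first.
    by apply: contraNF nIS' => /(maxS' _ (mem_head _ _)).
  by case: ifP => _; rewrite !inE eqxx.
have {ES'}memS' x : x \in S' -> x \in I \/ exists J, [/\ J \in L, J \subset S' & x \in J].
  move/(subsetP ES')/bigcup_seqP => [J []]; rewrite inE => /predU1P[->|LJ JS' Jx]; first by left.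
  by right; exists J.
have {}maxS' J : J \in L -> cf (J :|: S') -> J \subset S'.
  by move=> LJ; apply: maxS'; rewrite inE LJ orbT.
set T := below L S'; set P := greedy L T in HS *.
have TP : T \subset P by apply: greedy_sub.
have S'IT : S' = I :|: T.
  apply/eqP; rewrite eqEsubset subUset IS' below_subset !andbT; apply/subsetP => x.
  by case/memS' => [Ix|HJ]; rewrite inE ?Ix //; apply/orP; right; apply/belowP.
have [cfP memP maxP] := HS.
rewrite /children; case: ifP => [cfIP|ncf].
  rewrite inE eqEsubset {1}S'IT setUS //= subUset IS'; apply/subsetP => x /(subsetP memP).
  case/bigcup_seqP => J [LJ JP Jx]; apply: (subsetP (maxS' J LJ _)) => //.
  apply: cf_sub cfIP; rewrite subUset S'IT setUS // andbT.
  exact: subset_trans JP (subsetUr _ _).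
have EC : cand L I P = S'.
  apply/eqP; rewrite eqEsubset candE subUset IS' /=; apply/andP; split.
    apply/subsetP => x /bigcup_seqP[J [LJ /andP[JP cfJI] Jx]].
    (* [cfU3] for [J], [I], [T]: [J] is compatible with [I] by choice, [J] and [T] lie in [P], and
       [I :|: T] is [S']. *)
    apply: (subsetP (maxS' J LJ _)) => //; rewrite S'IT setUA; apply: cfU3 => //.
      by apply: cf_sub cfP; rewrite subUset JP.
    by rewrite -S'IT.
  apply/subsetP => x /memS'[Ix|[J [LJ JS' Jx]]]; rewrite inE ?Ix //.
  apply/orP; right; apply/bigcup_seqP; exists J; split=> //; apply/andP; split.
    by apply: subset_trans TP; apply: sub_below.
  by apply: cf_sub cfS'; rewrite subUset JS'.
by rewrite EC /legal_cand cfS' greedy_id // -/T -/P !eqxx !inE eqxx orbT.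
Qed.

Lemma max_union_nil S : max_union [::] S <-> S = set0.
Proof.
split=> [[_ + _]|->]; last by split; rewrite ?sub0set.
by rewrite big_nil subset0 => /eqP.
Qed.

Lemma max_union_mem L L' S : L =i L' -> max_union L S -> max_union L' S.
Proof.
move=> EL [cfS memS maxS]; split=> // [|J]; last by rewrite -EL; apply: maxS.
apply: subset_trans memS _; apply/subsetP => x /bigcup_seqP[J [LJ JS Jx]].
by apply/bigcup_seqP; exists J; rewrite -EL.
Qed.

(** Induction by levels: [s] lists a whole level without repetition, and the children of its nodes
    list the next one. *)
Lemma leaves_seq R L (s : seq {set A}) : uniq s -> (forall S, S \in s <-> max_union L S) ->
  let t := flatten [seq leaves L R T | T <- s] in
  uniq t /\ forall S, S \in t <-> max_union (catrev R L) S.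
Proof.
elim: R L s => [|I R IHR] L s Us Hs /=.
  by rewrite flatten_map1 map_id.
set s' := flatten [seq children L I T | T <- s].
have -> : flatten [seq flatten [seq leaves (I :: L) R S' | S' <- children L I T] | T <- s] =
    flatten [seq leaves (I :: L) R S' | S' <- s'].
  by rewrite /s'; elim: (s) => //= T s1 ->; rewrite map_cat flatten_cat.
apply: IHR => [|S']; last first.
  split=> [/flatten_mapP[S /Hs HS]|HS']; first exact: children_max_union.
  apply/flatten_mapP; exists (parent L I S'); last exact: mem_children_parent.
  by apply/Hs; apply: parent_max_union.
rewrite /s'; have {}Hs : {in s, forall S, max_union L S} by move=> S /Hs.
elim: s Us Hs {s'} => //= S s IHs /andP[sS Us] Hs.
have HS := Hs S (mem_head _ _); have [cfS _ _] := HS.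
rewrite cat_uniq children_uniq // IHs ?andbT //=; last by move=> T sT; apply: Hs; rewrite inE sT orbT.
(* A child shared by [S] and [T] would have both as its parent. *)
apply/hasPn => S' /flatten_mapP[T sT TS']; apply: contra sS => SS'.
rewrite -(children_parent HS SS') (children_parent _ TS') //.
by apply: Hs; rewrite inE sT orbT.
Qed.

Lemma leavesP R : uniq (leaves [::] R set0) /\
  forall S, S \in leaves [::] R set0 <-> max_union R S.
Proof.
have := @leaves_seq R [::] [:: set0] isT; rewrite /= cats0.
case=> [T|Ul Hl]; first by rewrite inE max_union_nil; split=> /eqP.
split=> // S; rewrite Hl; split; apply: max_union_mem => J; by rewrite -/(rev R) mem_rev.
Qed.

End MaximalUnions.

(** * Preferred extensions as maximal unions of irreducible sets *)

Section Frameworks.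
Variable F : framework.
Implicit Types S T J : {set arg F}.

Lemma conflict_freeP S :
  reflect {in S &, forall x y, (x, y) \notin attacks F} (conflict_free S).
Proof.
apply: (iffP eqP) => [S0 x y Sx Sy|HS].
  apply/negP => xy; have : y \in S :&: attacked_by S.
    by rewrite !inE Sy; apply/existsP; exists x; rewrite Sx.
  by rewrite S0 inE.
apply/setP => y; rewrite !inE; apply/andP => -[Sy /existsP[x /andP[Sx xy]]].
by have := HS x y Sx Sy; rewrite xy.
Qed.

Lemma conflict_free0 : conflict_free (set0 : {set arg F}).
Proof. by apply/conflict_freeP => x y; rewrite inE. Qed.

Lemma conflict_free_sub S T : S \subset T -> conflict_free T -> conflict_free S.
Proof.
move=> /subsetP ST /conflict_freeP cfT; apply/conflict_freeP => x y Sx Sy.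
by apply: cfT; apply: ST.
Qed.

Lemma conflict_freeU3 S T J : conflict_free (S :|: T) -> conflict_free (S :|: J) ->
  conflict_free (T :|: J) -> conflict_free (S :|: T :|: J).
Proof.
move=> /conflict_freeP cST /conflict_freeP cSJ /conflict_freeP cTJ.
apply/conflict_freeP => x y; rewrite !inE -!orbA => /or3P[] Hx /or3P[] Hy;
  by [apply: cST; rewrite inE ?Hx ?Hy ?orbT | apply: cSJ; rewrite inE ?Hx ?Hy ?orbT
     | apply: cTJ; rewrite inE ?Hx ?Hy ?orbT].
Qed.

Lemma self_defending_union S :
  (forall x, x \in S -> exists J, [/\ self_defending J, J \subset S & x \in J]) ->
  self_defending S.
Proof.
move=> HS; apply/subsetP => y; rewrite !inE => /existsP[x /andP[/HS[J [sdJ JS Jx]] yx]].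
have : y \in attackers_of J by rewrite inE; apply/existsP; exists x; rewrite Jx.
move/(subsetP sdJ); rewrite !inE => /existsP[z /andP[Jz zy]].
by apply/existsP; exists z; rewrite (subsetP JS).
Qed.

(** Strong induction on cardinality: a reducible set is the union of two strictly smaller
    self-defending sets, one of which contains [x]. *)
Lemma self_defendingP S : self_defending S ->
  forall x, x \in S -> exists J, [/\ J \in IRR F, J \subset S & x \in J].
Proof.
have [n] := ubnP #|S|; elim: n S => // n IHn S le_n sdS x Sx.
have [irrS|] := boolP (irreducible S).
  exists S; rewrite !inE sdS irrS andbT; split=> //.
  by apply/set0Pn; exists x.
have sub_split S1 : S1 \in SD F -> S1 \subset S -> S != S1 -> x \in S1 ->
    exists J, [/\ J \in IRR F, J \subset S & x \in J].
  rewrite inE => sd1 sub1 neq1 S1x; have ltS1 : #|S1| < #|S|.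
    by apply: proper_card; rewrite properEneq eq_sym neq1.
  have [J [irrJ JS1 Jx]] := IHn S1 (leq_trans ltS1 le_n) sd1 x S1x.
  by exists J; rewrite irrJ Jx (subset_trans JS1).
case/forall_inPn => S1 sd1 /forall_inPn[S2 sd2].
rewrite negb_imply negb_or => /and3P[/eqP ES neq1 neq2].
move: (Sx); rewrite {1}ES inE => /orP[].
  by apply: sub_split; rewrite // ES subsetUl.
by apply: sub_split; rewrite // ES subsetUr.
Qed.

(** Adding a compatible irreducible set to an admissible one keeps it admissible. Conversely, the
    irreducible parts of an admissible superset of [S] are compatible with [S], hence inside it. *)
Lemma PREF_max_union (irr : seq {set arg F}) S : irr =i IRR F ->
  S \in PREF F <-> max_union (@conflict_free F) irr S.
Proof.
move=> Eirr; rewrite inE; split=> [/maxsetP[/andP[cfS sdS] maxS]|[cfS memS maxS]].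
  split=> // [|J].
    apply/subsetP => x /(self_defendingP sdS)[J [irrJ JS Jx]]; apply/bigcup_seqP.
    by exists J; rewrite Eirr.
  rewrite Eirr !inE => /andP[sdJ _] cfJS; rewrite -(maxS (J :|: S)) ?subsetUl ?subsetUr //.
  rewrite /admissible cfJS; apply: self_defending_union => x.
  rewrite inE => /orP[Jx|Sx]; first by exists J; rewrite subsetUl.
  by exists S; rewrite subsetUr.
apply/maxsetP; split=> [|T /andP[cfT sdT] ST].
  rewrite /admissible cfS; apply: self_defending_union => x /(subsetP memS)/bigcup_seqP.
  by case=> J []; rewrite Eirr !inE => /andP[sdJ _] JS Jx; exists J.
apply/eqP; rewrite eqEsubset ST andbT; apply/subsetP => x.
case/(self_defendingP sdT) => J [irrJ JT Jx]; apply: (subsetP (maxS J _ _)) => //.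
  by rewrite Eirr.
by apply: conflict_free_sub cfT; rewrite subUset JT.
Qed.

End Frameworks.

(** * The step on encoded sets *)

(** The common pattern of [subsett], [disjt] and [cft]: a vector read in step with the folded
    list. *)
Lemma foldt_zip (T : Type) (enc : T -> tree) (f p : T -> bool) g e l b :
  (forall x t c, g (Node e (Node (enc x) (Node (Node (enc_bool (f x)) t) (enc_bool c)))) =
                 Node t (enc_bool (c && p x))) ->
  tl (foldt g e (enc_seq enc l) (Node (enc_seq (fun x => enc_bool (f x)) l) (enc_bool b))) =
  enc_bool (b && all p l).
Proof.
move=> Hg; rewrite /foldt elems_enc_seq; elim: l b => [|x l IHl] b /=; first by rewrite andbT.
by rewrite /fold_step Hg IHl andbA.
Qed.

Section Encodings.
Variable F : framework.
Implicit Types (S T I J C : {set arg F}) (L R : seq {set arg F}).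
Local Notation enc := (@enc_set (arg F)).
Local Notation encs := (enc_seq enc).
Local Notation mat := (enc_framework F).
Local Notation cf := (@conflict_free F).

Lemma uniont_enc S T : uniont (enc S) (enc T) = enc (S :|: T).
Proof.
rewrite uniontE /enc_set elems_enc_seq; elim: (enum _) => //= x s ->.
by rewrite inE; case: (x \in S) => //; case: (x \in T).
Qed.

Lemma subsett_enc S T : subsett (enc S) (enc T) = enc_bool (S \subset T).
Proof.
rewrite /subsett (foldt_zip (p := fun x => (x \in S) ==> (x \in T)) _ true) /=.
  congr enc_bool; apply/allP/subsetP => [H x Sx|ST x _]; last by apply/implyP/ST.
  by apply: (implyP (H x _)); rewrite ?mem_enum.
by move=> x t c; rewrite /subset_step /=; case: (x \in S); case: (x \in T); case: c.
Qed.

Lemma eqt_enc S T : eqt (enc S) (enc T) = enc_bool (S == T).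
Proof. by rewrite /eqt !subsett_enc cond_bool -eqEsubset. Qed.

Lemma cft_enc S : cft mat (enc S) = enc_bool (cf S).
Proof.
pose d x := [forall (y | y \in S), (x, y) \notin attacks F].
rewrite /cft (foldt_zip (p := fun x => (x \in S) ==> d x) _ true) /=.
  congr enc_bool; apply/allP/conflict_freeP => [H x y Sx Sy|H x _].
    by have /implyP/(_ Sx)/forall_inP := H x (mem_enum _ _); apply.
  by apply/implyP => Sx; apply/forall_inP => y; apply: H.
move=> x t c; rewrite /cf_step /=; congr Node.
have -> : disjt (enc_seq (fun y => enc_bool ((x, y) \in attacks F)) (enum (arg F))) (enc S) =
    enc_bool (d x).
  rewrite /disjt (foldt_zip (p := fun y => (y \in S) ==> ((x, y) \notin attacks F)) _ true) /=.
    by congr enc_bool; apply/allP/forallP => H y; [apply: H; rewrite mem_enum | move=> _].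
  by move=> y u b; rewrite /disj_step /=; case: ((x, y) \in _); case: (y \in S); case: b.
by case: (x \in S); case: (d x); case: c.
Qed.

Lemma greedyt_enc L S : greedyt mat (encs L) (enc S) = enc (greedy cf L S).
Proof.
apply: (foldt_enc (ea := enc)) => T J.
by rewrite /greedy_step /= !uniont_enc cft_enc condE; case: ifP.
Qed.

Lemma candt_enc L I S : candt mat (encs L) (enc I) (enc S) = enc (cand cf L I S).
Proof.
apply: (foldt_enc (ea := enc)) => T J.
by rewrite /cand_step /= !uniont_enc subsett_enc cft_enc !condE; case: (J \subset S); case: (cf _).
Qed.

Lemma zerot_enc (U : Type) (e : U -> tree) (l : seq U) :
  zerot (enc_seq e l) = enc_seq (fun=> Leaf) l.
Proof.
rewrite /zerot (foldt_enc (ea := fun n => iter n (Node Leaf) Leaf) (h := fun n _ => n.+1) _ _ 0) //.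
suff H n : iter (foldl (fun n _ => n.+1) n l) (Node Leaf) Leaf =
    iter n (Node Leaf) (enc_seq (fun=> Leaf) l) by rewrite H.
elim: l n => //= x l IHl n; by rewrite IHl iterSr.
Qed.

Lemma enc_set0 : enc set0 = enc_seq (fun=> Leaf) (enum (arg F)).
Proof. by rewrite /enc_set; elim: (enum _) => //= x l ->; rewrite inE. Qed.

Lemma belowt_enc L S : belowt (encs L) (enc S) = enc (below L S).
Proof.
have E : zerot (enc S) = enc set0 by rewrite {1}/enc_set zerot_enc enc_set0.
rewrite /belowt E; apply: (foldt_enc (ea := enc)) => T J.
by rewrite /below_step /= !uniont_enc subsett_enc condE; case: ifP.
Qed.

Lemma testt_enc L S C : testt mat (encs L) (enc S) (enc C) = enc_bool (legal_cand cf L S C).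
Proof. by rewrite /testt belowt_enc !greedyt_enc cft_enc !eqt_enc !cond_bool. Qed.

Lemma childrent_enc L I R S st :
  childrent mat (encs L) (enc I) (encs R) (enc S) st =
  foldr (fun S' st' => Node (node (encs (I :: L)) (encs R) (enc S')) st') st (children cf L I S).
Proof.
rewrite /childrent uniont_enc cft_enc candt_enc testt_enc !condE /children.
by case: ifP => //= _; case: ifP.
Qed.

Lemma initt_enc irr :
  initt (enc_input irr) = Node (Node (node Leaf (encs irr) (enc set0)) Leaf) mat.
Proof.
have E : zerot mat = enc set0 by rewrite /enc_framework zerot_enc enc_set0.
by rewrite /initt /= E.
Qed.

Lemma enc_seq_bool_size (U : Type) (f : U -> bool) l :
  tree_size (enc_seq (fun x => enc_bool (f x)) l) <= 4 * size l + 1.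
Proof. by elim: l => //= x l IHl; case: (f x) => /=; lia. Qed.

Lemma size_enc_seq (U : Type) (e : U -> tree) l : size l < tree_size (enc_seq e l).
Proof. elim: l => //= x l IHl; lia. Qed.

Lemma enc_set_size S : tree_size (enc S) <= 4 * tree_size mat.
Proof.
have := enc_seq_bool_size (fun x => x \in S) (enum (arg F)).
have := @size_enc_seq _ (fun x => enc_seq (fun y => enc_bool ((x, y) \in attacks F))
  (enum (arg F))) (enum (arg F)).
rewrite /enc_framework /enc_set; lia.
Qed.

(** Moving members from one list to the other keeps the total size; the extra one is the second
    closing [Leaf]. *)
Lemma catrev_enc_size (U : Type) (e : U -> tree) (l1 l2 : seq U) :
  (tree_size (enc_seq e (catrev l1 l2))).+1 = tree_size (enc_seq e l1) + tree_size (enc_seq e l2).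
Proof. by elim: l1 l2 => //= x l1 IHl l2; rewrite IHl /=; lia. Qed.

End Encodings.

(** * Running the search *)

Definition quiet (B : nat) (tr : trace) := all (fun e => (e.1 <= B) && ~~ isSome e.2) tr.

Definition emits (c : program) (s s' : store) (T B : nat) (t : tree) : Prop :=
  exists t1 t2 n, [/\ exec c s (t1 ++ (n, Some t) :: t2) s', size t1 + size t2 < T,
    n <= B, quiet B t1 & quiet B t2].

Lemma emits_seq_l T1 c1 c2 s1 s2 s3 T B t : emits c1 s1 s2 T1 B t -> T1 <= T ->
  runs c2 s2 s3 (T - T1) B -> emits (Seq c1 c2) s1 s3 T B t.
Proof.
move=> [t1 [t2 [n [ex sz le_n q1 q2]]]] leT [t3 [ex3 sz3 q3]].
exists t1, (t2 ++ t3), n; split=> //.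
- by rewrite -cat_cons catA; apply: ExecSeq ex ex3.
- by rewrite size_cat; lia.
- by rewrite /quiet all_cat; apply/andP.
Qed.

Lemma emits_seq_r T1 c1 c2 s1 s2 s3 T B t : runs c1 s1 s2 T1 B -> T1 <= T ->
  emits c2 s2 s3 (T - T1) B t -> emits (Seq c1 c2) s1 s3 T B t.
Proof.
move=> [t3 [ex3 sz3 q3]] leT [t1 [t2 [n [ex sz le_n q1 q2]]]].
exists (t3 ++ t1), t2, n; split=> //.
- by rewrite -catA; apply: ExecSeq ex3 ex.
- by rewrite size_cat; lia.
- by rewrite /quiet all_cat; apply/andP.
Qed.

Lemma emits_if x c1 c2 s s' T B t : read s x <> Leaf -> space s <= B ->
  emits c1 s s' T B t -> emits (If x c1 c2) s s' T.+1 B t.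
Proof.
move=> sx HB [t1 [t2 [n [ex sz le_n q1 q2]]]].
exists (tick s :: t1), t2, n; split=> //=; last by rewrite HB.
exact: ExecIfTrue ex.
Qed.

Lemma emits_output s x B t : read s x = t -> space s <= B -> emits (Output x) s s 1 B t.
Proof. by move=> <- HB; exists [::], [::], (space s); split=> //; apply: ExecOutput. Qed.

Lemma delays_quiet B d t tr : quiet B t -> delays d (t ++ tr) = delays (d + size t) tr.
Proof.
elim: t d => [|[n o] t IHt] d /=; first by rewrite addn0.
by case: o => [?|] /andP[/andP[_ //] _ qt]; rewrite IHt // addnS.
Qed.

Lemma outputs_quiet B t tr : quiet B t -> outputs (t ++ tr) = outputs tr.
Proof. by rewrite /outputs; elim: t => //= [[n [?|]] t IHt] /andP[/andP[_ //] _ /IHt]. Qed.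

Lemma space_quiet B t : quiet B t -> space_bounded B t.
Proof. by apply: sub_all => e /andP[]. Qed.

(** * The main loop, its delay and its space *)

Section MainLoop.
Variables (c : nat -> program) (w : nat) (p : nat -> nat).
Hypotheses (Cc : computes stept c w p) (Pp : polyf p).
Variables (m N : nat).
Hypothesis le_w : w <= m.+1.

(** At each loop test, register 0 holds the state and register 1 its stack; an empty stack ends the
    loop. The last [SetNil 1] only fills the silent branch. *)
Definition loop_body : program :=
  Seq (SetNil 1) (Seq (c 0) (Seq (SetHd 1 0)
  (Seq (If 1 (Seq (SetHd 1 1) (Output 1)) (SetNil 1))
  (Seq (SetTl 0 0) (SetHd 1 0))))).

Definition main_loop : program := While 1 loop_body.

Definition loop_store (u : tree) : store := [:: u, hd u & nseq m Leaf].

(** The 8 counts the loop test and the seven other steps of an iteration with output. *)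
Definition iter_time := p N + 8.
Definition iter_space := m + 2 * N + 2 * p N + 1.

Lemma loop_body_quiet u u' : tree_size u <= N -> stept u = Node Leaf u' ->
  runs loop_body (loop_store u) (loop_store u') iter_time.-1 iter_space.
Proof.
move=> le_u E; have le_hd := tree_size_hd u; have le_p := polyf_mono Pp le_u.
have := computes_size u Cc; rewrite E /= => le_u'; have le_hd' := tree_size_hd u'.
rewrite /iter_time /iter_space /loop_store.
apply: (runs_seq (T1 := 1) (s2 := [:: u, Leaf & nseq m Leaf])).
- by apply: (runs_nil (L := [::])) => //; rewrite ?spaceE /=; lia.
- by lia.
apply: (runs_seq (T1 := p N) (s2 := [:: Node Leaf u', Leaf & nseq m Leaf])).
- by rewrite -E; apply: (computes_at (L := [::]) (R := [::]) (m := m.+1) Cc); rewrite ?spaceE; lia.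
- by lia.
apply: (runs_seq (T1 := 1) (s2 := [:: Node Leaf u', Leaf & nseq m Leaf])).
- by apply: (runs_hd (L := [::])) => //; rewrite ?spaceE /=; lia.
- by lia.
apply: (runs_seq (T1 := 2) (s2 := [:: Node Leaf u', Leaf & nseq m Leaf])).
- apply: (runs_if (L := [::]) (R := [:: Node Leaf u', Leaf & nseq m Leaf])) => //.
    by rewrite ?spaceE /=; lia.
  by apply: (runs_nil (L := [::])) => //; rewrite ?spaceE /=; lia.
- by lia.
apply: (runs_seq (T1 := 1) (s2 := [:: u', Leaf & nseq m Leaf])).
- by apply: (runs_tl (L := [::])) => //; rewrite ?spaceE /=; lia.
- by lia.
by apply: (runs_hd (L := [::])) => //; rewrite ?spaceE /=; lia.
Qed.

Lemma loop_body_emits u u' t : tree_size u <= N -> stept u = Node (Node t Leaf) u' ->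
  emits loop_body (loop_store u) (loop_store u') iter_time.-1 iter_space t.
Proof.
move=> le_u E; have le_hd := tree_size_hd u; have le_p := polyf_mono Pp le_u.
have := computes_size u Cc; rewrite E => le_u'; have le_hd' := tree_size_hd u'.
rewrite /iter_time /iter_space /loop_store.
set v := Node _ u' in E le_u' *.
apply: (emits_seq_r (T1 := 1) (s2 := [:: u, Leaf & nseq m Leaf])).
- by apply: (runs_nil (L := [::])) => //; rewrite ?spaceE /=; lia.
- by lia.
apply: (emits_seq_r (T1 := p N) (s2 := [:: v, Leaf & nseq m Leaf])).
- by rewrite -E; apply: (computes_at (L := [::]) (R := [::]) (m := m.+1) Cc); rewrite ?spaceE; lia.
- by lia.
rewrite /= in le_u'.
apply: (emits_seq_r (T1 := 1) (s2 := [:: v, Node t Leaf & nseq m Leaf])).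
- by apply: (runs_hd (L := [::])) => //; rewrite ?spaceE /=; lia.
- by lia.
apply: (emits_seq_l (T1 := 3) (s2 := [:: v, t & nseq m Leaf])).
- apply: emits_if; rewrite ?spaceE /=; [by [] | lia |].
  apply: (emits_seq_r (T1 := 1) (s2 := [:: v, t & nseq m Leaf])) => //.
    by apply: (runs_hd (L := [::])) => //; rewrite ?spaceE /=; lia.
  by apply: emits_output => //; rewrite ?spaceE /=; lia.
- by lia.
apply: (runs_seq (T1 := 1) (s2 := [:: u', t & nseq m Leaf])).
- by apply: (runs_tl (L := [::])) => //; rewrite ?spaceE /=; lia.
- by lia.
by apply: (runs_hd (L := [::])) => //; rewrite ?spaceE /=; lia.
Qed.

Variables (A : finType) (B : nat).

(* [h] bounds the number of steps before the next output, or before the end if [l] is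
   empty: [d] steps already spent since the last output keep the delay below [B]. *)
Definition loop_ok (u : tree) (h : nat) (l : seq {set A}) : Prop :=
  exists tr s, [/\ exec main_loop (loop_store u) tr s,
    outputs tr = map (@enc_set A) l,
    forall d, d + h <= B -> all (fun d => d <= B) (delays d tr) &
    space_bounded iter_space tr].

Lemma loop_store_space u : tree_size u <= N -> space (loop_store u) <= iter_space.
Proof. by move=> le_u; rewrite /iter_space ?spaceE; have := tree_size_hd u; lia. Qed.

Lemma loop_ok_quiet u u' h l : hd u <> Leaf -> tree_size u <= N ->
  stept u = Node Leaf u' -> loop_ok u' h l -> loop_ok u (iter_time + h) l.
Proof.
move=> u0 le_u E [tr [s [ex out del sp]]].
have [t [ext szt qt]] := loop_body_quiet le_u E; have le_s := loop_store_space le_u.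
exists (tick (loop_store u) :: t ++ tr), s; split.
- exact: ExecWhileTrue ext ex.
- by rewrite /outputs /= -/(outputs _) (outputs_quiet _ qt).
- move=> d le_d; rewrite /= (delays_quiet _ _ qt); apply: del.
  by move: szt le_d; rewrite /iter_time /=; lia.
- by rewrite /space_bounded /= le_s all_cat /=; apply/andP; split; first apply: space_quiet qt.
Qed.

(** The steps after the output belong to the next delay; [iter_time + h <= B] leaves room for
    them. *)
Lemma loop_ok_emits u u' h S l : hd u <> Leaf -> tree_size u <= N ->
  stept u = Node (Node (enc_set S) Leaf) u' -> iter_time + h <= B ->
  loop_ok u' h l -> loop_ok u iter_time (S :: l).
Proof.
move=> u0 le_u E le_h [tr [s [ex out del sp]]].
have [t1 [t2 [n [ext sz le_n q1 q2]]]] := loop_body_emits le_u E.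
have le_s := loop_store_space le_u; rewrite /iter_time /= in sz.
exists (tick (loop_store u) :: (t1 ++ (n, Some (enc_set S)) :: t2) ++ tr), s; split.
- exact: ExecWhileTrue ext ex.
- rewrite /outputs /= -/(outputs _) -catA (outputs_quiet _ q1) /outputs /=.
  by rewrite -/(outputs _) (outputs_quiet _ q2) out.
- move=> d le_d; rewrite /= -catA (delays_quiet _ _ q1) /= (delays_quiet _ _ q2).
  apply/andP; split; first by move: le_d; rewrite /iter_time; lia.
  by apply: del; move: le_h; rewrite /iter_time; lia.
- rewrite /space_bounded /= le_s !all_cat /= le_n -andbA /=.
  by apply/and3P; split=> //; [apply: space_quiet q1 | apply: space_quiet q2].
Qed.

Lemma loop_ok_stop M : tree_size (Node Leaf M) <= N -> loop_ok (Node Leaf M) 1 [::].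
Proof.
move=> le_N; exists [:: tick (loop_store (Node Leaf M))], (loop_store (Node Leaf M)); split=> //.
- exact: ExecWhileFalse.
- by move=> d; rewrite addn1 /= andbT.
- by rewrite /space_bounded /= loop_store_space.
Qed.

End MainLoop.

(** * The depth-first traversal *)

Section Search.
Variables (c : nat -> program) (w : nat) (p : nat -> nat).
Hypotheses (Cc : computes stept c w p) (Pp : polyf p).
Variables (m : nat) (F : framework) (irr : seq {set arg F}).
Hypothesis le_w : w <= m.+1.
Local Notation enc := (@enc_set (arg F)).
Local Notation encs := (enc_seq enc).
Local Notation mat := (enc_framework F).
Local Notation cf := (@conflict_free F).
Local Notation n := (tree_size (enc_input irr)).

Definition node_bound k := 4 * k + 3.
(** At most [k] waiting nodes with their list cells, the current node, and the matrix. *)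
Definition state_bound k := k * (node_bound k).+1 + node_bound k + k + 3.

Local Notation N := (state_bound n).
Local Notation D := (iter_time p N).
Variable B : nat.
(** At most [size irr + 1] iterations lead down to a leaf; one more covers the end of the iteration
    of the previous output. *)
Hypothesis le_B : (size irr + 2) * D <= B.

Lemma node_size L R (S : {set arg F}) : catrev R L = rev irr ->
  tree_size (node (encs L) (encs R) (enc S)) <= node_bound n.
Proof.
move=> E; have := catrev_enc_size enc R L; rewrite E /rev.
have := catrev_enc_size enc irr [::]; have := enc_set_size S.
rewrite /node_bound /=; lia.
Qed.

(* A stack below a node of depth [k] has at most [k] entries, as each level leaves
   at most one sibling on it. *)
Lemma state_size L R (S : {set arg F}) st : catrev R L = rev irr ->
  tree_size st <= size L * (node_bound n).+1 + 1 ->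
  tree_size (Node (Node (node (encs L) (encs R) (enc S)) st) mat) <= N.
Proof.
move=> E le_st; have := node_size S E.
have sz_irr := size_enc_seq enc irr.
have : size L <= n.
  have := congr1 size E; rewrite catrevE size_cat !size_rev /=; lia.
set K := node_bound n in le_st *; move=> le_L le_S.
have : size L * K.+1 <= n * K.+1 by rewrite leq_mul2r le_L orbT.
rewrite /state_bound -/K /= in le_st le_S *; lia.
Qed.

(** The stack [st] acts as a continuation that outputs [l]. Since every node has a child, the first
    leaf is reached in [(size R).+1] iterations. *)
Lemma search_ok R L S st h l : catrev R L = rev irr ->
  tree_size st <= size L * (node_bound n).+1 + 1 -> D + h <= B ->
  loop_ok c p m N B (Node st mat) h l ->
  loop_ok c p m N B (Node (Node (node (encs L) (encs R) (enc S)) st) mat)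
    ((size R).+1 * D) (leaves cf L R S ++ l).
Proof.
elim: R L S st h l => [|I R IHR] L S st h l E le_st le_h ok_st.
  rewrite mul1n; apply: (loop_ok_emits Cc Pp le_w) le_h ok_st => //.
  exact: state_size.
have le_N := state_size S E le_st.
have Estep := childrent_enc L I R S st.
(* With a member left, [stept] reduces by conversion to this silent form. *)
rewrite mulSn; apply: (loop_ok_quiet Cc Pp le_w _ le_N (congr1 (fun t => Node Leaf (Node t mat)) Estep)) => //.
have le_st1 : tree_size st <= size (I :: L) * (node_bound n).+1 + 1.
  by apply: leq_trans le_st _; rewrite leq_add2r leq_mul2r leqnSn orbT.
have le_D : D + (size R).+1 * D <= B.
  have := congr1 size E; rewrite catrevE size_cat !size_rev /= => szE.
  rewrite -mulSn; apply: leq_trans le_B; rewrite leq_mul2r; apply/orP; right; lia.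
have ok1 T : loop_ok c p m N B (Node (Node (node (encs (I :: L)) (encs R) (enc T)) st) mat)
    ((size R).+1 * D) (leaves cf (I :: L) R T ++ l) by apply: IHR ok_st.
rewrite /= /children; case: ifP => _ /=; first by rewrite cats0.
case: ifP => _ /=; last by rewrite cats0.
(* The search below [S] comes first; the sibling [cand] waits on the stack as part of the
   continuation. *)
rewrite cats0 -catA; apply: (IHR (I :: L) S _ _ _ E _ le_D (ok1 (cand cf L I S))).
apply: (@leq_trans (node_bound n + tree_size st).+1).
  by rewrite ltnS leq_add2r; apply: (@node_size (I :: L) R _ E).
by rewrite [size (I :: L)]/= mulSn; lia.
Qed.

End Search.

(** * Initialisation and the complete program *)

Lemma write_nseq v k : write [:: v] k.+1 Leaf = v :: nseq k.+1 Leaf.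
Proof. by rewrite /write /=; congr cons; case: k => //= k; elim: k => //= k ->. Qed.

Theorem corollary1 :
  exists (M : program) (pdelay pspace : {poly nat}),
  forall (F : framework) (irr : seq {set arg F}),
    lists irr (IRR F) ->
    exists (tr : trace) (s' : store),
      [/\ exec M [:: enc_input irr] tr s',
          enumerates tr (PREF F),
          delay_bounded (pdelay.[tree_size (enc_input irr)])%R tr &
          space_bounded (pspace.[tree_size (enc_input irr)])%R tr].
Proof.
have [c [w [p [Pp Cc]]]] := polytime_stept.
have [ci [wi [pi [Ppi Cci]]]] := polytime_initt.
pose m := wi + w.
(* The input size is at least [size irr + 2], so the product covers every stretch of the search;
   [pi k + 3] covers the initialisation before the first output. *)
pose time k := (k + 2) * iter_time p (state_bound k) + pi k + 3.
pose room k := iter_space p m (state_bound k) + 2 * pi k + k + m + 1.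
have [pdelay Edelay] : exists q : {poly nat}, forall k, time k = (q.[k])%R.
  by apply: polyf_horner; rewrite /time /iter_time /state_bound /node_bound; polyf.
have [pspace Espace] : exists q : {poly nat}, forall k, room k = (q.[k])%R.
  by apply: polyf_horner; rewrite /room /iter_space /state_bound /node_bound; polyf.
exists (Seq (Seq (SetNil m.+1) (Seq (ci 0) (SetHd 1 0))) (main_loop c)), pdelay, pspace.
move=> F irr [_ irrE]; rewrite -Edelay -Espace.
set n := tree_size _; set v := enc_input irr.
have [U0 HU0] := leavesP (@conflict_free0 F) (@conflict_free_sub F) (@conflict_freeU3 F) irr.
set l := leaves _ _ _ _ in U0 HU0.
have le_n : size irr + 2 <= n.
  by have := size_enc_seq (@enc_set (arg F)) irr; have := tree_size_gt0 (enc_framework F);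
    rewrite /n /=; lia.
set u := initt v; have Eu : u = _ := initt_enc irr.
have [tr [s [ex out del sp]]] : loop_ok c p m (state_bound n) (time n) u
    ((size irr).+1 * iter_time p (state_bound n)) l.
  have le_time : (size irr + 2) * iter_time p (state_bound n) <= time n.
    by rewrite /time; have := leq_mul le_n (leqnn (iter_time p (state_bound n))); lia.
  rewrite Eu -[l]cats0; have le_w : w <= m.+1 by rewrite /m; lia.
  (* From the root, with an empty stack as continuation: it costs one step, the failing loop
     test. *)
  apply: (@search_ok c w p Cc Pp m F irr le_w (time n) le_time irr [::] set0 Leaf 1 [::]) => //.
  - by rewrite -/v -/n /time mulnDl; lia.
  apply: (loop_ok_stop _ _ le_w); apply: (@leq_trans (n + 3)); first by rewrite /n /v /=; lia.
  by rewrite -/v -/n /state_bound -[X in _ <= X]addnA leq_addl.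
have le_u : tree_size u <= pi n := computes_size v Cci.
have [t [ext szt qt]] : runs (Seq (SetNil m.+1) (Seq (ci 0) (SetHd 1 0))) [:: v]
    (loop_store m u) (pi n + 2) (room n).
  (* Writing register [m.+1] pads the store, which allocates all scratch registers at once. *)
  apply: (runs_seq (T1 := 1) (s2 := [:: v & nseq m.+1 Leaf])).
  - apply: (runs_nil (L := [::]) (R := [:: v])) => //; rewrite ?spaceE -/n; first by rewrite /room; lia.
    exact: write_nseq.
  - by lia.
  apply: (runs_seq (T1 := pi n) (s2 := [:: u & nseq m.+1 Leaf])).
  - have le_wi : wi <= m.+1 by rewrite /m; lia.
    by apply: (computes_at (L := [::]) (R := [::]) Cci) => //; rewrite ?spaceE -/n /room; lia.
  - by lia.
  apply: (runs_hd (L := [::]) (R := [:: u, Leaf & nseq m Leaf])) => //.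
    by lia.
  by rewrite /loop_store ?spaceE; have := tree_size_hd u; rewrite /room; lia.
exists (t ++ tr), s; split.
- exact: ExecSeq ext ex.
- exists l; last by rewrite (outputs_quiet _ qt).
  split=> // S; apply/idP/idP => [/HU0|] HS; first by apply/(PREF_max_union S irrE).
  by apply/HU0/(PREF_max_union S irrE).
- rewrite /delay_bounded (delays_quiet _ _ qt); apply: del.
  by rewrite /time; have := leq_mul le_n (leqnn (iter_time p (state_bound n))); lia.
- rewrite /space_bounded all_cat; apply/andP; split; first exact: (space_quiet qt).
  by apply: sub_all sp => e le_e; apply: leq_trans le_e _; rewrite /room; lia.
Qed.
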